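(* Let $d$ be a nonnegative integer. Let $A$ (resp. $A^*$) be a diagonalizable linear transformation on $V$ with eigenvalues $\{\theta_i\}_{i=0}^d$ (resp. $\{\theta^*_i\}_{i=0}^d$). Assume the pair $(A,A^* )$ is irreducible. Then the following (i), (ii) are equivalent. (i) The pair $(A,A^* )$ is Hessenberg with respect to $(\{\theta_i\}_{i=0}^d;\{\theta^*_i\}_{i=0}^d)$. (ii) There exists an $(A,A^* )$-split decomposition of $V$ with respect to $(\{\theta_i\}_{i=0}^d;\{\theta^*_i\}_{i=0}^d)$.
   Context: $\mathbb K$ is a field and $V$ is a nonzero finite-dimensional vector space over $\mathbb K$. A linear transformation on $V$ is a $\mathbb K$-linear map $V\to V$; it is diagonalizable if $V$ is spanned by its eigenspaces. $A$ and $A^*$ are arbitrary linear transformations ($A^*$ does not denote an adjoint or conjugate-transpose). Saying that $A$ has eigenvalues $\{\theta_i\}_{i=0}^d$ means that $\theta_0,\dots,\theta_d$ is an ordering, without repetition, of all the distinct eigenvalues of $A$; similarly for $A^*$. Irreducible: the pair $(A,A^* )$ is irreducible if there is no subspace $W$ of $V$ with $AW\subseteq W$, $A^*W\subseteq W$, $W\ne 0$, $W\ne V$. Hessenberg: let $V_i$ be the eigenspace of $A$ for $\theta_i$ and $V^*_i$ the eigenspace of $A^*$ for $\theta^*_i$ ($0\le i\le d$), and set $V_{d+1}=0$, $V^*_{d+1}=0$. The pair $(A,A^* )$ is Hessenberg with respect to $(\{\theta_i\}_{i=0}^d;\{\theta^*_i\}_{i=0}^d)$ if for all $0\le i\le d$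 both $A^*V_i\subseteq V_0+V_1+\cdots+V_{i+1}$ and $AV^*_i\subseteq V^*_0+V^*_1+\cdots+V^*_{i+1}$. Split decomposition: a decomposition of $V$ is a sequence $\{U_i\}_{i=0}^d$ of nonzero subspaces of $V$ such that $V=U_0+U_1+\cdots+U_d$ is a direct sum; set $U_{-1}=0$, $U_{d+1}=0$. An $(A,A^* )$-split decomposition of $V$ with respect to $(\{\theta_i\}_{i=0}^d;\{\theta^*_i\}_{i=0}^d)$ is a decomposition $\{U_i\}_{i=0}^d$ of $V$ such that for all $0\le i\le d$ both $(A-\theta_{d-i}I)U_i\subseteq U_{i+1}$ and $(A^*-\theta^*_iI)U_i\subseteq U_{i-1}$. *)

(* Defs.v *)
From mathcomp Require Import all_boot all_algebra.

Set Implicit Arguments.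
Unset Strict Implicit.
Unset Printing Implicit Defensive.

Import GRing.Theory passmx.
Local Open Scope ring_scope.

Section HessenbergPairs.

Variables (K : fieldType) (V : vectType K).
Implicit Types (A As : 'End(V)) (W : {vspace V}).

Definition lfun_diagonalizable A : Prop :=
  exists s : seq K,
    all (leigenvalue A) s /\ (\sum_(a <- s) leigenspace A a)%VS = fullv.

Definition irreducible_pair A As : Prop :=
  ~ exists W,
      [/\ (A @: W <= W)%VS, (As @: W <= W)%VS, W != 0%VS & W != fullv].

Variable d : nat.
Implicit Types (theta thetas : 'I_d.+1 -> K) (U : 'I_d.+1 -> {vspace V}).

Definition has_eigenvalues A theta : Prop :=
  injective theta /\
  forall a : K, leigenvalue A a <-> exists i, theta i = a.

(* The convention that a family U_0, ..., U_d is extended by U_(d+1) = 0. *)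
Definition component U (k : nat) : {vspace V} :=
  if insub k is Some i then U i else 0%VS.

(* U_(k-1), with the convention U_(-1) = 0. *)
Definition pred_component U (k : nat) : {vspace V} :=
  if k is k'.+1 then component U k' else 0%VS.

Definition hessenberg A As theta thetas : Prop :=
  let E i := leigenspace A (theta i) in
  let Es i := leigenspace As (thetas i) in
  forall i : 'I_d.+1,
    (As @: E i <= \sum_(j < i.+2) component E j)%VS /\
    (A @: Es i <= \sum_(j < i.+2) component Es j)%VS.

Definition decomposition U : Prop :=
  [/\ forall i, U i != 0%VS, directv (\sum_i U i)
    & (\sum_i U i)%VS = fullv].

(* rev_ord i is the index d - i. *)
Definition split_decomposition A As theta thetas U : Prop :=
  decomposition U /\
  forall i : 'I_d.+1,
    ((A - theta (rev_ord i) *: \1%VF) @: U i <= component U i.+1)%VS /\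
    ((As - thetas i *: \1%VF) @: U i <= pred_component U i)%VS.

End HessenbergPairs.

(* Main.v *)
(* Let [F k] and [G k] be the sums of the first [k] eigenspaces of [As] and of
   [A].  In a Hessenberg pair, [A - theta_j] maps [F (i+1) :&: G (j+1)] into
   [F (i+2) :&: G j] and [As - thetas_i] maps it into [F i :&: G (j+2)].  Hence
   along an antidiagonal the sum of these intersections is invariant under both
   maps, so it is [0] or everything.  Below the main antidiagonal it lies in a
   proper [G r], so it is [0], which makes the intersections on the main
   antidiagonal independent; they form the split decomposition.  Conversely, a
   split decomposition has partial sums [F k] from the bottom and [G k] from the
   top, and each of [A], [As] raises the other's flag by one step. *)

Require Import Defs.
From mathcomp Require Import all_boot all_algebra.

Set Implicit Arguments.
Unset Strict Implicit.
Unset Printing Implicit Defensive.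

Import GRing.Theory passmx.
Local Open Scope ring_scope.

(** * Shifts of an endomorphism by a scalar *)

Section Shift.

Variables (K : fieldType) (V : vectType K).
Implicit Types (B : 'End(V)) (W X : {vspace V}).

Lemma shift_lfunE B c v : (B - c *: \1%VF) v = B v - c *: v.
Proof. by rewrite add_lfunE opp_lfunE scale_lfunE id_lfunE. Qed.

Lemma leigenspaceP B c v : reflect (B v = c *: v) (v \in leigenspace B c).
Proof.
by rewrite /leigenspace memv_ker shift_lfunE subr_eq0; apply: eqP.
Qed.

Lemma limg_subP B W X :
  reflect {in W, forall v, B v \in X} (B @: W <= X)%VS.
Proof.
apply: (iffP idP) => [BWX v Wv | BWX].
  exact: subvP BWX _ (memv_img B Wv).
by apply/subvP=> _ /memv_imgP[v Wv ->]; apply: BWX.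
Qed.

(** The multiples [c *: v] already lie in [X], so the scalar may be dropped or exchanged for another
    one. *)
Lemma limg_shift_sub B c W X : (W <= X)%VS ->
  ((B - c *: \1%VF) @: W <= X)%VS = (B @: W <= X)%VS.
Proof.
move=> /subvP WX; apply/limg_subP/limg_subP=> BW v Wv; have := BW v Wv;
by rewrite shift_lfunE rpredBr // memvZ // WX.
Qed.

Lemma limg_shift_leigenspace B c :
  ((B - c *: \1%VF) @: leigenspace B c = 0)%VS.
Proof. by apply/eqP; rewrite -lkerE. Qed.

End Shift.

(** * Partial sums of a family of subspaces, and maps that raise or lower them *)

Section PartialSums.

Variables (K : fieldType) (V : vectType K) (d : nat).
Implicit Types (B : 'End(V)) (W : {vspace V}) (U : 'I_d.+1 -> {vspace V}).

Lemma component_ord U (i : 'I_d.+1) : component U i = U i.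
Proof. by rewrite /component valK. Qed.

Lemma component_out U k : (d < k)%N -> component U k = 0%VS.
Proof. by move=> dk; rewrite /component insubN // -leqNgt. Qed.

Lemma component_nat (X : nat -> {vspace V}) k :
    (forall j, (d < j)%N -> X j = 0%VS) ->
  component (fun i : 'I_d.+1 => X i) k = X k.
Proof.
move=> X0; case: (ltnP k d.+1) => kd; last by rewrite component_out ?X0.
by rewrite (component_ord _ (Ordinal kd)).
Qed.

(** Reversal swaps the conventions U_(-1) = 0 and U_(d+1) = 0, so a map that raises a family lowers
    the reversed one. *)
Lemma pred_component_rev U (i : 'I_d.+1) :
  pred_component (fun j => U (rev_ord j)) i = component U (rev_ord i).+1.
Proof.
case: i => [[|i] lid] /=; first by rewrite component_out ?subn1.
rewrite (component_ord _ (Ordinal (ltnW lid))).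
have -> : (d.+1 - i.+2).+1 = rev_ord (Ordinal (ltnW lid)) by rewrite /= subnSK.
by rewrite component_ord.
Qed.

Lemma component_rev U (i : 'I_d.+1) :
  component (fun j => U (rev_ord j)) i.+1 = pred_component U (rev_ord i).
Proof.
rewrite -{1}[i]rev_ordK -pred_component_rev.
case: (val _) => //= k; rewrite /component.
by case: insub => //= j; rewrite rev_ordK.
Qed.

Definition psum U k := (\sum_(j < k) component U j)%VS.

Lemma psum0 U : psum U 0 = 0%VS.
Proof. by rewrite /psum big_ord0. Qed.

Lemma psumS U k : psum U k.+1 = (psum U k + component U k)%VS.
Proof. by rewrite /psum big_ord_recr. Qed.

Lemma psum_subP U k W :
  reflect (forall i : 'I_d.+1, (i < k)%N -> U i <= W)%VS (psum U k <= W)%VS.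
Proof.
apply: (iffP subv_sumP) => [UW i ik | UW j _].
  by have := UW (Ordinal ik) isT; rewrite /= component_ord.
case: (ltnP j d.+1) => jd; last by rewrite component_out ?sub0v.
by rewrite (component_ord _ (Ordinal jd)) UW /=.
Qed.

Lemma sub_psum U k (i : 'I_d.+1) : (i < k)%N -> (U i <= psum U k)%VS.
Proof. by move: i; apply/psum_subP. Qed.

Lemma psum_mono U k m : (k <= m)%N -> (psum U k <= psum U m)%VS.
Proof.
by move=> km; apply/psum_subP => i ik; apply/sub_psum/(leq_trans ik).
Qed.

Lemma component_sub_psum U k : (component U k <= psum U k.+1)%VS.
Proof. by rewrite psumS addvSr. Qed.

Lemma pred_component_sub_psum U k : (pred_component U k <= psum U k)%VS.
Proof. by case: k => [|k]; rewrite ?sub0v ?component_sub_psum. Qed.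

Lemma psum_full U k : (d < k)%N -> psum U k = (\sum_i U i)%VS.
Proof.
move=> dk; apply/eqP; rewrite eqEsubv; apply/andP; split.
  by apply/psum_subP=> i _; apply: (sumv_sup i).
by apply/subv_sumP=> i _; apply/sub_psum/(leq_trans (ltn_ord i)).
Qed.

Lemma limg_psumP B U k W :
  reflect (forall i : 'I_d.+1, (i < k)%N -> B @: U i <= W)%VS
          (B @: psum U k <= W)%VS.
Proof.
apply: (iffP idP) => [BW i ik | BW].
  exact: subv_trans (limgS _ (sub_psum _ ik)) BW.
apply/limg_subP => v /memv_sumP[w Uw ->].
rewrite linear_sum memv_suml // => j _.
have := Uw j isT; case: (ltnP j d.+1) => jd.
  rewrite (component_ord _ (Ordinal jd)) => Uj.
  exact: (limg_subP _ _ _ (BW (Ordinal jd) (ltn_ord j))).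
by rewrite component_out // memv0 => /eqP->; rewrite linear0 mem0v.
Qed.

Lemma limg_psum_raise B U (c : 'I_d.+1 -> K) k :
    (forall i : 'I_d.+1, (B - c i *: \1%VF) @: U i <= component U i.+1)%VS ->
  (B @: psum U k <= psum U k.+1)%VS.
Proof.
move=> BU; apply/limg_psumP=> i ik.
rewrite -(limg_shift_sub _ (c i)); last exact/sub_psum/leqW.
apply: subv_trans (BU i) (subv_trans (component_sub_psum U _) _).
exact: psum_mono.
Qed.

Lemma limg_psum_lower B U (c : 'I_d.+1 -> K) (i : 'I_d.+1) :
    (forall i : 'I_d.+1, (B - c i *: \1%VF) @: U i <= pred_component U i)%VS ->
  ((B - c i *: \1%VF) @: psum U i.+1 <= psum U i)%VS.
Proof.
move=> BU; have BUi (j : 'I_d.+1) :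
    ((B - c j *: \1%VF) @: U j <= psum U j)%VS.
  exact: subv_trans (BU j) (pred_component_sub_psum _ _).
apply/limg_psumP=> j; rewrite ltnS leq_eqVlt => /predU1P[/val_inj-> // | ji].
have Uj := sub_psum U ji.
(* Below the top summand, [U j] is inside the target, so [c i] can be exchanged for [c j], the
   scalar adapted to [U j]. *)
rewrite limg_shift_sub // -(limg_shift_sub _ (c j)) //.
exact: subv_trans (BUi j) (psum_mono _ (ltnW ji)).
Qed.

End PartialSums.

(** * The flag of partial sums of eigenspaces *)

Section EigenspaceFlag.

Variables (K : fieldType) (V : vectType K) (d : nat).
Variables (B : 'End(V)) (mu : 'I_d.+1 -> K).

Definition eigenspace_flag := psum (fun i => leigenspace B (mu i)).

Lemma limg_shift_eigenspace_flag (i : 'I_d.+1) :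
  ((B - mu i *: \1%VF) @: eigenspace_flag i.+1 <= eigenspace_flag i)%VS.
Proof.
by apply: limg_psum_lower => j; rewrite limg_shift_leigenspace sub0v.
Qed.

Hypothesis mu_eig : has_eigenvalues B mu.

Lemma leigenspace_neq0 i : leigenspace B (mu i) != 0%VS.
Proof. by apply/(mu_eig.2 (mu i)); exists i. Qed.

Lemma eigenspace_flag_full k :
  lfun_diagonalizable B -> (d < k)%N -> eigenspace_flag k = fullv.
Proof.
move=> [s [/allP eig_s full_s]] dk; apply/eqP; rewrite eqEsubv subvf /=.
rewrite -full_s big_seq; elim/big_ind: _ => [|U W UV WV|a /eig_s].
- exact: sub0v.
- by rewrite subv_add UV.
case/(mu_eig.2 a)=> i <-; apply: (sub_psum (fun i => leigenspace B (mu i))).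
exact: leq_trans (ltn_ord i) dk.
Qed.

Lemma mu_subr_neq0 (i j : 'I_d.+1) : (i < j)%N -> mu i - mu j != 0.
Proof.
move=> ij; rewrite subr_eq0; apply: contraTneq ij => /mu_eig.1->.
by rewrite ltnn.
Qed.

(** For [k < i], the shift by [mu k] scales [v] by the nonzero [mu i - mu k] and takes level [k.+1]
    to level [k]; so [v] descends to level 0. *)
Lemma eigenspace_flag_eigenvector v (i : 'I_d.+1) k :
  (k <= i)%N -> v \in eigenspace_flag k -> v \in leigenspace B (mu i) -> v = 0.
Proof.
move=> ki Fv /leigenspaceP Ev; elim: k ki Fv => [_|k IHk ki Fv].
  by rewrite /eigenspace_flag psum0 memv0 => /eqP.
have kd : (k < d.+1)%N := ltn_trans ki (ltn_ord i).
have := limg_subP _ _ _ (limg_shift_eigenspace_flag (Ordinal kd)) v Fv.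
rewrite shift_lfunE Ev -scalerBl rpredZeq -oppr_eq0 opprB.
rewrite (negPf (mu_subr_neq0 _)) //=; apply: IHk; exact: ltnW.
Qed.

Lemma eigenspace_flag_neq_full k : (k <= d)%N -> eigenspace_flag k != fullv.
Proof.
rewrite -ltnS => kd; apply: contraNneq (leigenspace_neq0 (Ordinal kd)) => Ff.
rewrite -subv0; apply/subvP=> v Ev; rewrite memv0; apply/eqP.
by apply: (@eigenspace_flag_eigenvector v (Ordinal kd) k); rewrite ?Ff ?memvf.
Qed.

Lemma mem_eigenspace_flag v (i : 'I_d.+1) :
    B v - mu i *: v \in eigenspace_flag i ->
  v \in eigenspace_flag i.+1.
Proof.
(* [B - mu i] maps the flag at level [i] onto itself, so [v] differs from a
   vector of that level by an eigenvector. *)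
move=> Bv; suff [w Fw Bw] :
    exists2 w, w \in eigenspace_flag i & B w - mu i *: w = B v - mu i *: v.
  rewrite -(subrK w v) /eigenspace_flag psumS addrC memv_add // component_ord.
  apply/leigenspaceP; apply/eqP; rewrite linearB scalerBr -subr_eq0.
  by rewrite opprB [mu i *: w - _]addrC addrACA -Bw addrACA subrr addNr addr0.
move: Bv; rewrite {1}/eigenspace_flag => /memv_sumP[w Ew ->].
have Ej (j : 'I_i) : w j \in leigenspace B (mu (inord j)).
  have := Ew j isT.
  rewrite -[X in component _ X](@inordK d j) ?component_ord //.
  exact: ltn_trans (ltn_ord j) (ltn_ord i).
have ji (j : 'I_i) : ((inord j : 'I_d.+1) < i)%N.
  by rewrite inordK // (ltn_trans (ltn_ord j)).
(* The shift by [mu i] acts on the eigenspace of index [j < i] as the nonzero scalar [mu j - mu i],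
   so it is inverted there by division. *)
exists (\sum_(j < i) (mu (inord j) - mu i)^-1 *: w j).
  apply: memv_suml => j _; apply: memvZ.
  exact: (subvP (sub_psum _ (ji j))) (Ej j).
rewrite linear_sum scaler_sumr -sumrB; apply: eq_bigr => j _.
rewrite linearZ /= (leigenspaceP _ _ _ (Ej j)) !scalerA [mu i * _]mulrC.
by rewrite -scalerBl -mulrBr mulVf ?scale1r // mu_subr_neq0.
Qed.

(** This recovers eigenspaces from a split decomposition: only the partial sums agree, not the
    summands themselves. *)
Lemma psum_eigenspace_flag (U : 'I_d.+1 -> {vspace V}) k :
    (\sum_i U i)%VS = fullv ->
    (forall i : 'I_d.+1, (B - mu i *: \1%VF) @: U i <= pred_component U i)%VS ->
  psum U k = eigenspace_flag k.
Proof.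
move=> fullU BU; apply/eqP; rewrite eqEsubv; apply/andP; split.
  elim: k => [|k IHk]; first by rewrite psum0 sub0v.
  rewrite psumS subv_add (subv_trans IHk) ?psum_mono //=.
  case: (ltnP k d.+1) => kd; last by rewrite component_out ?sub0v.
  rewrite (component_ord _ (Ordinal kd)); apply/subvP => v Uv.
  apply: (@mem_eigenspace_flag v (Ordinal kd)); rewrite -shift_lfunE.
  apply: (subvP (subv_trans (subv_trans (BU (Ordinal kd)) _) IHk)).
    exact: pred_component_sub_psum.
  exact: memv_img.
apply/psum_subP=> i ik; apply/subvP=> v Ev.
(* Descending induction on [k], from [k > d] where the partial sum is everything. The shift by
   [mu k] lowers level [k.+1] to level [k] and scales [v] by [mu i - mu k], nonzero as [i < k]. *)
have [n] := ubnP (d.+1 - k); elim: n k ik => // n IHn k ik; rewrite ltnS => dkn.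
case: (ltnP k d.+1) => kd; last by rewrite psum_full // fullU memvf.
have /(limg_subP _ _ _ (limg_psum_lower (Ordinal kd) BU) v) : v \in psum U k.+1.
  by apply: IHn; [exact: ltnW | rewrite subnS prednK ?subn_gt0].
rewrite shift_lfunE (leigenspaceP _ _ _ Ev) -scalerBl rpredZeq.
by rewrite (negPf (mu_subr_neq0 _)).
Qed.

End EigenspaceFlag.

(** * From a Hessenberg pair to a split decomposition *)

Lemma hessenberg_limg_flag (K : fieldType) (V : vectType K) (d : nat)
    (B C : 'End(V)) (mu : 'I_d.+1 -> K) k :
    (forall i : 'I_d.+1,
       C @: leigenspace B (mu i) <= eigenspace_flag B mu i.+2)%VS ->
  (C @: eigenspace_flag B mu k <= eigenspace_flag B mu k.+1)%VS.
Proof.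
by move=> CE; apply/limg_psumP=> i ik; apply: subv_trans (CE i) (psum_mono _ _).
Qed.

Section HessenbergToSplit.

Variables (K : fieldType) (V : vectType K) (d : nat) (A As : 'End(V)).
Variables (theta thetas : 'I_d.+1 -> K).
Hypotheses (diagA : lfun_diagonalizable A) (eigA : has_eigenvalues A theta).
Hypothesis eigAs : has_eigenvalues As thetas.
Hypothesis irr : irreducible_pair A As.
Hypothesis hess : hessenberg A As theta thetas.

Local Notation F := (eigenspace_flag As thetas).
Local Notation G := (eigenspace_flag A theta).

Lemma irreducible_invariant W :
  (A @: W <= W)%VS -> (As @: W <= W)%VS -> W = 0%VS \/ W = fullv.
Proof.
move=> AW AsW; case: (eqVneq W 0%VS) => [|W0]; first by left.
by case: (eqVneq W fullv) => [|Wf]; [right | case: irr; exists W].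
Qed.

(** Here [r] numbers the antidiagonal and [k] the position on it. The main one is [r = d.+1], where
    [G] stops at the eigenspace of index [d - k]. Truncated subtraction makes the entries with
    [k >= r] zero. *)
Definition diag_cap r k := (F k.+1 :&: G (r - k))%VS.

Lemma diag_cap_out r k : (r <= k)%N -> diag_cap r k = 0%VS.
Proof.
by rewrite -subn_eq0 /diag_cap => /eqP->; rewrite /eigenspace_flag psum0 capv0.
Qed.

Lemma limg_shift_diag_cap r k (i : 'I_d.+1) : (r - k)%N = i.+1 ->
  ((A - theta i *: \1%VF) @: diag_cap r k <= diag_cap r k.+1)%VS.
Proof.
move=> rki; rewrite subv_cap; apply/andP; split.
  apply: subv_trans (limgS _ (capvSl _ _)) _.
  rewrite limg_shift_sub ?psum_mono //.
  by apply: hessenberg_limg_flag => j; have [] := hess j.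
apply: subv_trans (limgS _ (capvSr _ _)) _.
by rewrite rki subnS rki; apply: limg_shift_eigenspace_flag.
Qed.

(** At [i = 0] the image falls into [F 0], which is 0; this is the left end of the antidiagonal. *)
Lemma limg_shift_dual_diag_cap r (i : 'I_d.+1) : (i < r)%N ->
  ((As - thetas i *: \1%VF) @: diag_cap r i <=
     if nat_of_ord i is k.+1 then diag_cap r k else 0)%VS.
Proof.
move=> ir; have : ((As - thetas i *: \1%VF) @: diag_cap r i <= F i)%VS.
  apply: subv_trans (limgS _ (capvSl _ _)) _.
  exact: limg_shift_eigenspace_flag.
case: (nat_of_ord i) ir => [|k] kr FX.
  by rewrite /eigenspace_flag psum0 in FX.
rewrite subv_cap FX /=; apply: subv_trans (limgS _ (capvSr _ _)) _.
rewrite -(subnSK (ltnW kr)) limg_shift_sub ?psum_mono //.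
by apply: hessenberg_limg_flag => j; have [] := hess j.
Qed.

(** [As] moves entries to the left and [A] to the right, so a sum cut off at [m] could fail to be
    invariant only through entry [m], which vanishes. The cut is at [m = r] for whole antidiagonals,
    and earlier to show that no entry of the main one vanishes. *)
Lemma sum_diag_cap r m : (m <= r <= d.+1)%N -> diag_cap r m = 0%VS ->
  let W := (\sum_(k < m) diag_cap r k)%VS in W = 0%VS \/ W = fullv.
Proof.
move=> /andP[mr rd] Xm W.
have XW k : (k < m)%N -> (diag_cap r k <= W)%VS.
  by move=> km; apply: (sumv_sup (Ordinal km)).
have kr (k : 'I_m) : (k < r)%N by apply: leq_trans mr.
apply: irreducible_invariant; rewrite limg_sum; apply/subv_sumP => k _.
  (* The last eigenspace in [G (r - k)] has index [r - k.+1]; its eigenvalue is the one to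
     subtract. *)
  have id : (r - k.+1 < d.+1)%N.
    by apply: leq_trans rd; rewrite ltn_subrL (leq_trans _ (kr k)).
  rewrite -(limg_shift_sub _ (theta (Ordinal id))) ?XW //.
  apply: subv_trans (limg_shift_diag_cap _) _; first by rewrite /= subnSK.
  have := ltn_ord k; rewrite leq_eqVlt.
  by case/predU1P=> [->|]; [rewrite Xm sub0v | exact: XW].
pose i := Ordinal (leq_trans (kr k) rd).
rewrite -(limg_shift_sub _ (thetas i)) ?XW //.
apply: subv_trans (limg_shift_dual_diag_cap (i := i) (kr k)) _ => /=.
case: (nat_of_ord k) (ltn_ord k) => [|k' km]; first by rewrite sub0v.
exact/XW/ltnW.
Qed.

Lemma diag_cap_eq0 r k : (r <= d)%N -> diag_cap r k = 0%VS.
Proof.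
move=> rd; case: (leqP r k) => [|kr]; first exact: diag_cap_out.
have [||W0|Wf] := @sum_diag_cap r r; first by rewrite leqnn leqW.
- exact: diag_cap_out.
- apply/eqP; rewrite -subv0 -W0; exact: (sumv_sup (Ordinal kr)).
case/eqP: (eigenspace_flag_neq_full eigA rd).
apply/eqP; rewrite eqEsubv subvf -Wf; apply/subv_sumP=> j _.
by apply: subv_trans (capvSr _ _) (psum_mono _ (leq_subr _ _)).
Qed.

(** As [G d.+1] is everything, this entry is [F 1], the first eigenspace of [As]. It rules out the
    zero alternative for sums on the main antidiagonal. *)
Lemma diag_cap0_neq0 : diag_cap d.+1 0 != 0%VS.
Proof.
rewrite /diag_cap subn0 (eigenspace_flag_full eigA) // capvf.
apply: contraNneq (leigenspace_neq0 eigAs ord0) => F0.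
by rewrite -subv0 -F0 (sub_psum (fun i => leigenspace As (thetas i))).
Qed.

Lemma sum_diag_cap_full : (\sum_(i < d.+1) diag_cap d.+1 i)%VS = fullv.
Proof.
have [||W0|//] := @sum_diag_cap d.+1 d.+1; first by rewrite leqnn.
  exact: diag_cap_out.
case/eqP: diag_cap0_neq0; apply/eqP; rewrite -subv0 -W0.
exact: (sumv_sup (ord0 : 'I_d.+1)).
Qed.

(** If a later entry [i] vanished, the sum of the entries before it would be everything, yet it lies
    in the proper subspace [F i]. *)
Lemma diag_cap_neq0 (i : 'I_d.+1) : diag_cap d.+1 i != 0%VS.
Proof.
case: i => [[|i] lid] /=; first exact: diag_cap0_neq0.
apply/eqP=> Xi; have [||W0|Wf] := @sum_diag_cap d.+1 i.+1; rewrite ?Xi //.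
- by rewrite leqnn ltnW.
- case/eqP: diag_cap0_neq0; apply/eqP; rewrite -subv0 -W0.
  exact: (sumv_sup (ord0 : 'I_i.+1)).
case/eqP: (eigenspace_flag_neq_full eigAs (k := i.+1) lid).
apply/eqP; rewrite eqEsubv subvf -Wf; apply/subv_sumP=> j _.
by apply: subv_trans (capvSl _ _) (psum_mono _ (ltn_ord j)).
Qed.

Lemma diag_cap_direct : directv (\sum_(i < d.+1) diag_cap d.+1 i).
Proof.
apply/directv_sum_independent=> us Xus sum0 i _.
have [n] := ubnP (nat_of_ord i); elim: n i => // n IHn i; rewrite ltnS => le_in.
(* Once the earlier terms vanish, [us i] is minus the sum of the later ones, which all lie in
   [G (d - i)]. It is also in [F i.+1], hence in entry [i] of the antidiagonal [d], which is 0. *)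
apply/eqP; rewrite -memv0 -(@diag_cap_eq0 d i) // memv_cap.
have /memv_capP[-> _] := Xus i isT; rewrite /=.
move/eqP: sum0; rewrite (bigD1 i) //= addr_eq0 => /eqP->.
rewrite rpredN memv_suml // => j; rewrite neq_ltn => /orP[ji|ij].
  by rewrite IHn ?mem0v // (leq_trans ji).
have /memv_capP[_] := Xus j isT; apply/subvP/psum_mono.
by rewrite -(subSS i d) leq_sub2l.
Qed.

Lemma hessenberg_split :
  split_decomposition A As theta thetas (fun i => diag_cap d.+1 i).
Proof.
have compX k :
    component (fun i : 'I_d.+1 => diag_cap d.+1 i) k = diag_cap d.+1 k.
  by apply: component_nat => j; apply: diag_cap_out.
split; first by split;
  [exact: diag_cap_neq0 | exact: diag_cap_direct | exact: sum_diag_cap_full].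
move=> i; split; first by rewrite compX limg_shift_diag_cap //= subnSK.
have := limg_shift_dual_diag_cap (ltn_ord i).
by rewrite /pred_component /=; case: (nat_of_ord i) => // k; rewrite compX.
Qed.

End HessenbergToSplit.

(** * From a split decomposition to a Hessenberg pair *)

Lemma split_hessenberg (K : fieldType) (V : vectType K) (d : nat)
    (A As : 'End(V)) (theta thetas : 'I_d.+1 -> K) (U : 'I_d.+1 -> {vspace V}) :
    has_eigenvalues A theta -> has_eigenvalues As thetas ->
    split_decomposition A As theta thetas U ->
  hessenberg A As theta thetas.
Proof.
move=> eigA eigAs [[_ _ fullU] splitU].
(* In reversed order [A] lowers and [As] raises, so the partial sums of [U'] form the flag of [A],
   as those of [U] form the flag of [As]. *)
pose U' i := U (rev_ord i).
have fullU' : (\sum_i U' i)%VS = fullv.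
  by rewrite -fullU [RHS](reindex_inj rev_ord_inj).
have AU' i : ((A - theta i *: \1%VF) @: U' i <= pred_component U' i)%VS.
  rewrite pred_component_rev; have [] := splitU (rev_ord i).
  by rewrite rev_ordK.
have AsU' i :
    ((As - thetas (rev_ord i) *: \1%VF) @: U' i <= component U' i.+1)%VS.
  by rewrite component_rev; have [] := splitU (rev_ord i).
have AsU i := (splitU i).2; have AU i := (splitU i).1.
have AsE k :
    (As @: eigenspace_flag A theta k <= eigenspace_flag A theta k.+1)%VS.
  rewrite -!(psum_eigenspace_flag eigA _ fullU' AU').
  exact: limg_psum_raise AsU'.
have AEs k :
    (A @: eigenspace_flag As thetas k <= eigenspace_flag As thetas k.+1)%VS.
  rewrite -!(psum_eigenspace_flag eigAs _ fullU AsU).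
  exact: limg_psum_raise AU.
move=> i; split; [apply: subv_trans (AsE i.+1) | apply: subv_trans (AEs i.+1)];
  apply: limgS; apply: (sub_psum (fun j => leigenspace _ (_ j))); exact: ltnSn.
Qed.

Theorem corollary1p9 (K : fieldType) (V : vectType K)
    (V_neq0 : (fullv : {vspace V}) != 0%VS)
    (d : nat) (A As : 'End(V)) (theta thetas : 'I_d.+1 -> K)
    (diagA : lfun_diagonalizable A) (eigA : has_eigenvalues A theta)
    (diagAs : lfun_diagonalizable As) (eigAs : has_eigenvalues As thetas)
    (irr : irreducible_pair A As) :
  hessenberg A As theta thetas <->
  exists U : 'I_d.+1 -> {vspace V}, split_decomposition A As theta thetas U.
Proof.
split=> [hess | [U splitU]]; last exact: split_hessenberg splitU.
by exists (fun i => diag_cap A As theta thetas d.+1 i); apply: hessenberg_split.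
Qed.
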